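(* Let $D$ be an integral domain. For each $P\in\mathrm{Spec}(D)$, denote by $b_P$ the $b$-operation on the localization $D_P$ and by $\iota_P:D\hookrightarrow D_P$ the canonical inclusion. (1) If $D$ is $b$-Noetherian, then $D_P$ is $b_P$-Noetherian for every $P\in\mathrm{Spec}(D)$. (2) $b=\bigwedge (b_P)^{\iota_P}$, where $P$ varies over $\mathrm{Spec}(D)$; that is, $E^b=\bigcap\{(ED_P)^{b_P}\mid P\in\mathrm{Spec}(D)\}$ for every nonzero $D$-submodule $E$ of the quotient field of $D$.
   Context: Let $R$ be an integral domain with quotient field $K$. An overring of $R$ is a ring $T$ with $R\subseteq T\subseteq K$; a valuation overring is an overring which is a valuation domain. The $b$-operation of $R$ is defined, for each nonzero $R$-submodule $E$ of $K$, by $E^{b}:=\bigcap\{EV \mid V \text{ valuation overring of } R\}$. $R$ is Noetherian with respect to its $b$-operation ($b$-Noetherian) if the ascending chain condition holds on quasi-$b$-ideals of $R$, i.e. nonzero ideals $I$ of $R$ with $I^b\cap R=I$; equivalently, for each nonzero ideal $I$ of $R$ there is a finitely generated ideal $F\subseteq I$ with $F^b=I^b$. The semistar operation $(b_P)^{\iota_P}$ on $D$ is defined by $E^{(b_P)^{\iota_P}}:=(ED_P)^{b_P}$. *)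

(* Defs.v *)
(* MathComp with the classical sets of MathComp-Analysis. *)
From HB Require Import structures.
From mathcomp Require Import all_boot all_algebra.
From mathcomp Require Import boolp classical_sets.

Set Implicit Arguments.
Unset Strict Implicit.
Unset Printing Implicit Defensive.

Import GRing.Theory.
Local Open Scope classical_set_scope.
Local Open Scope ring_scope.

(* Integral domains are handled as subrings R of an ambient field L, so that
   a domain, its localizations and its overrings live in the same type. Only
   the quotient field of R inside L matters, not L itself. *)
Section SubringsOfAField.
Variable L : fieldType.
Implicit Types (R T V E F I S : set L) (star : set L -> set L).

Definition is_subring R : Prop := GRing.subring_closed [in R].

Definition quotient_field R : set L :=
  [set x | exists a b, [/\ R a, R b, b != 0 & x = a / b]].

Definition overring R T : Prop :=
  [/\ is_subring T, R `<=` T & T `<=` quotient_field R].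

Definition valuation_domain V : Prop :=
  is_subring V /\ (forall x, quotient_field V x -> x != 0 -> V x \/ V x^-1).

Definition valuation_overring R V : Prop :=
  overring R V /\ valuation_domain V.

Definition is_submodule R E : Prop :=
  [/\ zmod_closed [in E], forall r x, R r -> E x -> E (r * x)
    & E `<=` quotient_field R].

Definition is_ideal R I : Prop := is_submodule R I /\ I `<=` R.

(* The additive group generated by the products x * y, x in E and y in F. *)
Definition module_prod E F : set L :=
  [set z | exists (n : nat) (x y : 'I_n -> L),
     [/\ forall i, E (x i), forall i, F (y i) & z = \sum_(i < n) x i * y i]].

Definition b_op R E : set L :=
  \bigcap_(V in valuation_overring R) module_prod E V.

(* For star a semistar operation on an overring T of R with inclusion iota,
   this is the semistar operation star^iota on R. *)
Definition pullback_op T star : set L -> set L :=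
  fun E => star (module_prod E T).

Definition quasi_star_ideal R star I : Prop :=
  [/\ is_ideal R I, I <> [set 0] & star I `&` R = I].

Definition star_noetherian R star : Prop :=
  forall I : nat -> set L,
    (forall n, quasi_star_ideal R star (I n)) ->
    (forall n, I n `<=` I n.+1) ->
    exists N, forall n, (N <= n)%N -> I n = I N.

Definition b_noetherian R : Prop := star_noetherian R (b_op R).

End SubringsOfAField.

Section Localization.
Variable D : idomainType.

Definition base_ring : set {fraction D} := range (@FracField.tofrac D).

(* The type prime_idealr D ranges over boolean predicates; classically these
   are all the prime ideals of D (including the zero ideal, not D itself). *)
Definition localization (P : prime_idealr D) : set {fraction D} :=
  [set x | exists a s : D,
     s \notin (P : {pred D}) /\
     x = FracField.tofrac a / FracField.tofrac s].

End Localization.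

Arguments base_ring : clear implicits.

(* Main.v *)
Require Import Defs.
From HB Require Import structures.
From mathcomp Require Import all_boot all_algebra.
From mathcomp Require Import boolp classical_sets.

(** Both parts rest on comparing the valuation overrings of a domain [R] with
those of an overring [T]. Since [R] and [T] have the same quotient field, the
valuation overrings of [T] are exactly the valuation overrings of [R] that
contain [T] ([valuation_overring_sub], [valuation_overring_super]); and for
such a [V] the products [(ET)V] and [EV] agree ([module_prodA]).

Hence the semistar operation that the [b]-operation of [T] induces on [R] is
the intersection of the [EV] over the [V] containing [T]. A family of overrings
therefore recovers the [b]-operation of [R] as soon as each valuation overring
of [R] contains a member of the family ([b_op_bigcap_pullback]). The
localizations of [D] form such a family: the nonunits of [V] lying in [D] are a
prime ideal [P] of [D], the center of [V], and elements of [D] outside [P] are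
units of [V], so [D_P] is contained in [V] ([valuation_overring_center]).

For the chain condition, let [I] be a quasi-[b]-ideal of [D_P]. Fewer valuation
overrings are intersected over [D_P] than over [D], and so the [b]-closure of
[I] contains that of its contraction; the contraction is then a
quasi-[b]-ideal of [D] ([quasi_b_ideal_contraction]). Every ideal of a ring of
fractions is determined by its contraction ([sub_of_contraction]), so a chain
of quasi-[b]-ideals of [D_P] stabilizes when the contracted chain does. *)

Local Open Scope classical_set_scope.
Local Open Scope ring_scope.

Set Implicit Arguments.
Unset Strict Implicit.
Unset Printing Implicit Defensive.

Import GRing.Theory.

(** * Subrings and products of modules *)

Lemma is_subringP (L : fieldType) (R : set L) :
  is_subring R <-> [/\ R 1, forall x y, R x -> R y -> R (x - y)
                     & forall x y, R x -> R y -> R (x * y)].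
Proof.
split=> -[R1 RB RM]; split.
- exact: set_mem R1.
- by move=> x y Rx Ry; apply/set_mem/RB; apply/mem_set.
- by move=> x y Rx Ry; apply/set_mem/RM; apply/mem_set.
- exact: mem_set.
- by move=> x y /set_mem Rx /set_mem Ry; apply/mem_set/RB.
- by move=> x y /set_mem Rx /set_mem Ry; apply/mem_set/RM.
Qed.

Lemma zmod_closedP (L : fieldType) (E : set L) :
  GRing.zmod_closed [in E] <-> E 0 /\ forall x y, E x -> E y -> E (x - y).
Proof.
split=> -[E0 EB]; split.
- exact: set_mem E0.
- by move=> x y Ex Ey; apply/set_mem/EB; apply/mem_set.
- exact: mem_set.
- by move=> x y /set_mem Ex /set_mem Ey; apply/mem_set/EB.
Qed.

Lemma subring1 (L : fieldType) (R : set L) : is_subring R -> R 1.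
Proof. by case/is_subringP. Qed.

Lemma subringM (L : fieldType) (R : set L) x y :
  is_subring R -> R x -> R y -> R (x * y).
Proof. by case/is_subringP=> _ _; apply. Qed.

Lemma subringD (L : fieldType) (R : set L) x y :
  is_subring R -> R x -> R y -> R (x + y).
Proof.
case/is_subringP=> R1 RB _ Rx Ry; rewrite -[y]opprK; apply: (RB) => //.
by rewrite -sub0r -(subrr 1); apply: (RB) => //; apply: RB.
Qed.

Lemma mem_quotient_field (L : fieldType) (R : set L) :
  is_subring R -> R `<=` quotient_field R.
Proof.
move=> Rring x Rx; exists x, 1; split=> //; first exact: subring1.
- exact: oner_neq0.
- by rewrite divr1.
Qed.

Lemma module_prod_mul (L : fieldType) (E F : set L) x y :
  E x -> F y -> module_prod E F (x * y).
Proof.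
by move=> Ex Fy; exists 1%N, (fun=> x), (fun=> y); rewrite big_ord1.
Qed.

Lemma module_prod0 (L : fieldType) (E F : set L) : module_prod E F 0.
Proof.
by exists 0%N, (fun=> 0), (fun=> 0); split; [case | case | rewrite big_ord0].
Qed.

Lemma module_prodD (L : fieldType) (E F : set L) z1 z2 :
  module_prod E F z1 -> module_prod E F z2 -> module_prod E F (z1 + z2).
Proof.
move=> [m [x1 [y1 [Ex1 Fy1 ->]]]] [n [x2 [y2 [Ex2 Fy2 ->]]]].
pose glue (u : 'I_m -> L) (v : 'I_n -> L) (i : 'I_(m + n)) :=
  match split i with inl j => u j | inr k => v k end.
exists (m + n)%N, (glue x1 x2), (glue y1 y2); split.
- by move=> i; rewrite /glue; case: (split i).
- by move=> i; rewrite /glue; case: (split i).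
rewrite big_split_ord /glue; congr (_ + _); apply: eq_bigr => i _.
- by rewrite (unsplitK (inl i)).
- by rewrite (unsplitK (inr i)).
Qed.

(** The induction principle for products: it avoids reindexing the nested sums
that appear when a product of three factors is reassociated. *)
Lemma module_prod_min (L : fieldType) (E F G : set L) :
  G 0 -> (forall x y, G x -> G y -> G (x + y)) ->
  (forall x y, E x -> F y -> G (x * y)) ->
  module_prod E F `<=` G.
Proof.
move=> G0 GD GM _ [n [x [y [Ex Fy ->]]]].
by elim/big_ind: _ => // i _; apply: GM.
Qed.

Lemma module_prodSl (L : fieldType) (E E' F : set L) :
  E `<=` E' -> module_prod E F `<=` module_prod E' F.
Proof.
move=> sEE' z [n [x [y [Ex Fy ->]]]]; exists n, x, y; split=> // i.
exact/sEE'/Ex.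
Qed.

Lemma sub_module_prod (L : fieldType) (E T : set L) :
  T 1 -> E `<=` module_prod E T.
Proof. by move=> T1 x Ex; rewrite -[x]mulr1; apply: module_prod_mul. Qed.

(** Extending a module to [T] first does not change its extension to a larger
ring [V], because [TV = V]. *)
Lemma module_prodA (L : fieldType) (E T V : set L) :
  T 1 -> is_subring V -> T `<=` V ->
  module_prod (module_prod E T) V = module_prod E V.
Proof.
move=> T1 Vring sTV; apply/seteqP; split; last first.
  exact/module_prodSl/sub_module_prod.
apply: module_prod_min; [exact: module_prod0 | exact: module_prodD |].
move=> x v + Vv; move: x.
(* The elements whose product with [v] lies in [EV] form an additive monoid. *)
apply: (@module_prod_min _ _ _ [set x | module_prod E V (x * v)]) => /=.
- by rewrite mul0r; apply: module_prod0.
- by move=> x y ? ?; rewrite mulrDl; apply: module_prodD.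
- move=> x t Ex Tt; rewrite -mulrA; apply: module_prod_mul => //.
  by apply: subringM => //; apply: sTV.
Qed.

(** * Valuation overrings of a domain and of its overrings *)

Lemma quotient_field_overring (L : fieldType) (R T : set L) :
  is_subring R -> overring R T -> quotient_field T = quotient_field R.
Proof.
move=> Rring [_ sRT sTK]; apply/seteqP; split; last first.
  by move=> _ [a [b [Ra Rb b0 ->]]]; exists a, b; split=> //; apply: sRT.
move=> _ [_ [_ [/sTK[a [s [Ra Rs s0 ->]]] /sTK[b [t [Rb Rt t0 ->]]] + ->]]].
rewrite mulf_eq0 invr_eq0 (negPf t0) orbF => b0.
exists (a * t), (s * b); split; try exact: subringM.
- by rewrite mulf_neq0.
- by rewrite invf_div mulf_div.
Qed.

Lemma valuation_overring_sub (L : fieldType) (R T V : set L) :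
  is_subring R -> overring R T -> valuation_overring T V ->
  valuation_overring R V.
Proof.
move=> Rring oT [[Vring sTV sVK] valV]; split=> //; split=> //.
- by case: oT => _ sRT _; apply: subset_trans sRT sTV.
- by rewrite -(quotient_field_overring Rring oT).
Qed.

Lemma valuation_overring_super (L : fieldType) (R T V : set L) :
  is_subring R -> overring R T -> valuation_overring R V -> T `<=` V ->
  valuation_overring T V.
Proof.
move=> Rring oT [[Vring sRV sVK] valV] sTV; split=> //; split=> //.
by rewrite (quotient_field_overring Rring oT).
Qed.

(** * The [b]-operation as a meet over overrings *)

(** For each [i] the right-hand side intersects the [EV] over the valuation
overrings [V] containing [T i], and by hypothesis no [V] escapes all [i]. *)
Lemma b_op_bigcap_pullback (L : fieldType) (J : Type) (R : set L)
    (T : J -> set L) (E : set L) :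
  is_subring R -> (forall i, overring R (T i)) ->
  (forall V, valuation_overring R V -> exists i, T i `<=` V) ->
  b_op R E = \bigcap_(i in [set: J]) pullback_op (T i) (b_op (T i)) E.
Proof.
move=> Rring oT domT; apply/seteqP; split=> x Hx.
  move=> i _ V TV; have [[Vring sTV _] _] := TV.
  rewrite module_prodA //; first exact/Hx/(valuation_overring_sub Rring (oT i)).
  by apply: subring1; case: (oT i).
move=> V RV; have [i sTV] := domT V RV; have [[Vring _ _] _] := RV.
rewrite -(@module_prodA _ _ (T i)) //; last by apply: subring1; case: (oT i).
exact/(Hx i I)/(valuation_overring_super Rring (oT i)).
Qed.

(** * Contracting ideals from a ring of fractions *)

Lemma sub_b_op (L : fieldType) (R E : set L) : E `<=` b_op R E.
Proof.
by move=> x Ex V [[Vring _ _] _]; apply: sub_module_prod => //; apply: subring1.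
Qed.

(** Passing to an overring leaves fewer valuation overrings to intersect. *)
Lemma b_op_overring (L : fieldType) (R T E F : set L) :
  is_subring R -> overring R T -> E `<=` F -> b_op R E `<=` b_op T F.
Proof.
move=> Rring oT sEF x Ex V TV.
exact/(module_prodSl sEF)/Ex/(valuation_overring_sub Rring oT).
Qed.

(** This is the ring of fractions of [R] at some multiplicative set, which is
left implicit: the largest choice is the set of elements of [R] that are units
of [T]. *)
Definition fraction_overring (L : fieldType) (R T : set L) : Prop :=
  overring R T /\
  forall x, T x -> exists s, [/\ R s, s != 0, T s^-1 & R (s * x)].

(** Multiplying by a suitable denominator, a unit of [T], moves an element of an
ideal of [T] into [R] without leaving the ideal, and this can be undone. *)
Lemma sub_of_contraction (L : fieldType) (R T I J : set L) :
  fraction_overring R T -> is_ideal T I -> is_ideal T J ->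
  I `&` R `<=` J `&` R -> I `<=` J.
Proof.
move=> [[_ sRT _] fracT] [[_ IM _] sIT] [[_ JM _] _] sIJ x Ix.
have [s [Rs s0 Ts Rsx]] := fracT x (sIT x Ix).
rewrite -[x](mulKf s0); apply: JM => //.
have /sIJ[] // : (I `&` R) (s * x) by split=> //; apply: IM => //; apply: sRT.
Qed.

(** The closure of the contraction over [R] lies in the closure of [I] over
[T] by [b_op_overring], and the latter meets [R] inside [I]. *)
Lemma quasi_b_ideal_contraction (L : fieldType) (R T I : set L) :
  is_subring R -> fraction_overring R T ->
  quasi_star_ideal T (b_op T) I -> quasi_star_ideal R (b_op R) (I `&` R).
Proof.
move=> Rring fT; have [oT fracT] := fT; have [Tring sRT _] := oT.
have /is_subringP[R1 RB RM] := Rring.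
move=> [idI I0 closI]; have [[/zmod_closedP[Iz IB] IM IK] sIT] := idI.
split.
- split; last by move=> x [].
  split; last by move=> x [_]; apply: mem_quotient_field.
  + apply/zmod_closedP; split; first by split=> //; rewrite -(subrr 1); apply: RB.
    by move=> x y [Ix Rx] [Iy Ry]; split; [apply: IB | apply: RB].
  + by move=> r x Rr [Ix Rx]; split; [apply/IM/Ix/sRT | apply: RM].
- move=> IR0; apply: I0; apply/seteqP; split=> x; last by move=> /= ->.
  move=> Ix; have [s [Rs s0 _ Rsx]] := fracT x (sIT x Ix).
  have : (I `&` R) (s * x) by split=> //; apply: IM => //; apply: sRT.
  by rewrite IR0 /= => /eqP; rewrite mulf_eq0 (negPf s0) => /eqP.
- apply/seteqP; split=> x; last by move=> IRx; split; [apply: sub_b_op|case: IRx].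
  move=> [bx Rx]; split=> //; rewrite -closI; split; last exact: sRT.
  exact: (b_op_overring Rring oT (@subIsetl _ I R)).
Qed.

Lemma b_noetherian_fraction_overring (L : fieldType) (R T : set L) :
  is_subring R -> fraction_overring R T -> b_noetherian R -> b_noetherian T.
Proof.
move=> Rring fT noethR I qI incI.
have [|n x [Ix Rx]|N stabN] := noethR (fun n => I n `&` R).
- by move=> n; apply: quasi_b_ideal_contraction fT _.
- by split=> //; apply: incI.
exists N => n leNn; have idI k : is_ideal T (I k) by case: (qI k).
by apply/seteqP; split; apply: (sub_of_contraction fT) => //; rewrite stabN.
Qed.

(** * The center of a valuation overring *)

(** Nonunits of [V] are closed under addition: if for instance [y / x] lies in
[V], then [x + y = x * (1 + y / x)] is a multiple of [x] in [V], so [x] is a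
unit as soon as [x + y] is one. *)
Lemma valuation_unitD (L : fieldType) (V : set L) x y :
  valuation_domain V -> V x -> V y -> x + y != 0 -> V (x + y)^-1 ->
  (x != 0 /\ V x^-1) \/ (y != 0 /\ V y^-1).
Proof.
move=> [Vring valV] Vx Vy xy0 Vxy.
have [x0|x0] := eqVneq x 0.
  by right; move: xy0 Vxy; rewrite x0 add0r.
have [y0|y0] := eqVneq y 0.
  by left; move: xy0 Vxy; rewrite y0 addr0.
have key u v : u != 0 -> u + v != 0 -> V (u + v)^-1 -> V (v / u) -> V u^-1.
  move=> u0 uv0 Vuv Vvu.
  have -> : u^-1 = (u + v)^-1 * (1 + v / u).
    by rewrite -(divff u0) -mulrDl mulKf.
  by apply: subringM => //; apply: subringD => //; apply: subring1.
have Kxy : quotient_field V (x / y) by exists x, y.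
have [|Vxdy|Vydx] := valV _ Kxy; first by rewrite mulf_neq0 ?invr_eq0.
- by right; split=> //; apply: (key y x) => //; rewrite addrC.
- by left; split=> //; apply: (key x y) => //; rewrite -invf_div.
Qed.

Lemma subring_unitM (L : fieldType) (V : set L) x y :
  is_subring V -> V x -> x * y != 0 -> V (x * y)^-1 -> y != 0 /\ V y^-1.
Proof.
move=> Vring Vx; rewrite mulf_eq0 negb_or => /andP[x0 y0] Vxy; split=> //.
by rewrite -[y^-1](mulVKf x0) -invfM; apply: subringM.
Qed.

Lemma base_ring_subring (D : idomainType) : is_subring (base_ring D).
Proof.
apply/is_subringP; split.
- by exists 1 => //; apply: rmorph1.
- by move=> _ _ [a _ <-] [b _ <-]; exists (a - b) => //; apply: rmorphB.
- by move=> _ _ [a _ <-] [b _ <-]; exists (a * b) => //; apply: rmorphM.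
Qed.

(** The prime [P] consists of the elements of [D] that are nonunits of [V], so
the denominators allowed in [localization P] are inverted in [V]. *)
Lemma valuation_overring_center (D : idomainType) (V : set {fraction D}) :
  valuation_overring (base_ring D) V ->
  exists P : prime_idealr D, localization P `<=` V.
Proof.
move=> [[Vring sDV _] valV].
have VD a : V (FracField.tofrac a) by apply: sDV; exists a.
pose unitV (a : D) :=
  FracField.tofrac a != 0 /\ V (FracField.tofrac a)^-1.
pose c : D -> bool := fun a => ~~ `[< unitV a >].
have cP a : reflect (~ unitV a) (a \in c) by apply: asboolPn.
have cid : idealr_closed c.
  split.
  - by apply/cP; rewrite /unitV rmorph0 eqxx => -[].
  - apply/cP => nu; apply: nu; rewrite /unitV rmorph1 invr1 oner_neq0.
    by split=> //; apply: subring1.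
  - move=> a u v /cP nu /cP nv; apply/cP; rewrite /unitV rmorphD rmorphM.
    move=> [uv0 Vuv].
    have Vau : V (FracField.tofrac a * FracField.tofrac u) by apply: subringM.
    have [[au0 Wau]|//] := valuation_unitD valV Vau (VD v) uv0 Vuv.
    exact/nu/(subring_unitM Vring (VD a)).
have cprime : prime_idealr_closed c.
  move=> u v /cP nuv; apply: contrapT => /negP.
  rewrite negb_or => /andP[/cP/contrapT[u0 Vu] /cP/contrapT[v0 Vv]]; apply: nuv.
  rewrite /unitV rmorphM mulf_neq0 // invfM; split=> //; exact: subringM.
pose idc := isIdealr.Build D c cid.
pose prc := isPrimeIdealrClosed.Build D c cprime.
pose P : prime_idealr D := HB.pack c idc prc.
exists P => _ [a [s [sNP ->]]]; apply: subringM => //.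
by have /cP/contrapT[] : s \notin c by [].
Qed.

(** * Localizations *)

Lemma tofrac_neq0 (D : idomainType) (P : prime_idealr D) (s : D) :
  s \notin (P : {pred D}) -> FracField.tofrac s != 0.
Proof. by apply: contra; rewrite tofrac_eq0 => /eqP ->; apply: rpred0. Qed.

Lemma localization_overring (D : idomainType) (P : prime_idealr D) :
  overring (base_ring D) (localization P).
Proof.
have P1 : 1 \notin (P : {pred D}) by rewrite idealr1.
have PM s t : s \notin (P : {pred D}) -> t \notin (P : {pred D}) ->
    s * t \notin (P : {pred D}).
  by move=> sP tP; rewrite prime_idealrM negb_or sP.
split.
- apply/is_subringP; split.
  + by exists 1, 1; rewrite rmorph1 divr1.
  + move=> _ _ [a [s [sP ->]]] [b [t [tP ->]]].
    exists (a * t - b * s), (s * t); split; first exact: PM.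
    rewrite -mulNr addf_div ?(tofrac_neq0 sP) ?(tofrac_neq0 tP) //.
    by rewrite rmorphB !rmorphM mulNr.
  + move=> _ _ [a [s [sP ->]]] [b [t [tP ->]]].
    exists (a * b), (s * t); split; first exact: PM.
    by rewrite mulf_div !rmorphM.
- by move=> _ [a _ <-]; exists a, 1; rewrite rmorph1 divr1.
- move=> _ [a [s [sP ->]]].
  exists (FracField.tofrac a), (FracField.tofrac s); split=> //.
  + by exists a.
  + by exists s.
  + exact: tofrac_neq0 sP.
Qed.

Lemma localization_fraction_overring (D : idomainType) (P : prime_idealr D) :
  fraction_overring (base_ring D) (localization P).
Proof.
split=> [|_ [a [s [sP ->]]]]; first exact: localization_overring.
have s0 := tofrac_neq0 sP; exists (FracField.tofrac s); split=> //.
- by exists s.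
- by exists 1, s; rewrite rmorph1 div1r.
- by exists a; rewrite // mulrC divfK.
Qed.

Theorem proposition14 (D : idomainType) :
  (b_noetherian (base_ring D) ->
     forall P : prime_idealr D, b_noetherian (localization P)) /\
  (forall E : set {fraction D},
     is_submodule (base_ring D) E -> E <> [set 0] ->
     b_op (base_ring D) E =
     \bigcap_(P in [set: prime_idealr D])
        pullback_op (localization P) (b_op (localization P)) E).
Proof.
split=> [noethD P|E _ _].
- apply: b_noetherian_fraction_overring noethD; first exact: base_ring_subring.
  exact: localization_fraction_overring.
- apply: b_op_bigcap_pullback; first exact: base_ring_subring.
  + exact: localization_overring.
  + exact: valuation_overring_center.
Qed.
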